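(* Let $B,B'\in M_n(R)$ and suppose $B'=A^\nabla BA$ for some non-singular matrix $A\in M_n(R)$ (i.e. $B$ is tropically similar to $B'$). Then $f_{B'}\models_{gs}f_B$, where $f_M(x)=\det(xI+M)$ is the characteristic polynomial.
   Context: Supertropical semiring $R=T\cup G\cup\{-\infty\}$: $T=\mathcal G$ an ordered abelian group (tangible), $G=\{a^\nu\}$ a copy (ghost); $a+b$ is the element of larger $\nu$-value if the $\nu$-values differ and $a^\nu$ if equal; multiplication adds $\nu$-values, is ghost if a factor is ghost, $-\infty$ absorbing; $0_R=-\infty$, $1_R=0$. Ghost surpassing: $a\models_{gs}b$ iff $a=b$, or $a\in G$ with $\nu$-value of $a$ $\geq$ that of $b$; for polynomials $\sum a_ix^i\models_{gs}\sum b_ix^i$ iff $a_i\models_{gs}b_i$ for all $i$. $\det(A)=\sum_{\sigma\in S_n}\prod_i a_{i,\sigma(i)}$; $A$ non-singular iff $\det(A)\in T$. $\operatorname{adj}(A)_{i,j}=\det(A_{j,i})$, $A^\nabla=\det(A)^{-1}\operatorname{adj}(A)$ for non-singular $A$. The characteristic polynomial $f_M(x)=\det(xI+M)\in R[x]$ is a formal polynomial whose coefficient of $x^k$ is the sum of the determinants of all $(n-k)\times(n-k)$ principal submatrices of $M$ (coefficient of $x^n$ is $1_R$). *)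

(* Defs.v *)
From HB Require Import structures.
From mathcomp Require Import all_boot all_order all_algebra all_fingroup.
Set Implicit Arguments. Unset Strict Implicit. Unset Printing Implicit Defensive.
Import GRing.Theory.
Local Open Scope ring_scope.

Definition ordered_abgroup (G : zmodType) (le : rel G) : Prop :=
  [/\ (forall a, le a a),
      (forall a b c, le a b -> le b c -> le a c),
      (forall a b, le a b -> le b a -> a = b),
      (forall a b, le a b || le b a)
    & (forall a b c, le a b -> le (a + c) (b + c))].

Section Supertropical.
Variables (G : zmodType) (le : rel G).

(* R = T u G u {-oo}: [Zero] is -oo, [Tan a] tangible, [Gh a] = a^nu ghost. *)
Inductive st : Type := Zero | Tan of G | Gh of G.

Definition lt_ (a b : G) := le a b && ~~ le b a.

Definition st_add (x y : st) : st :=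
  match x, y with
  | Zero, _ => y
  | _, Zero => x
  | Tan a, Tan b | Tan a, Gh b | Gh a, Tan b | Gh a, Gh b =>
      if lt_ a b then y else if lt_ b a then x else Gh a
  end.

Definition st_mul (x y : st) : st :=
  match x, y with
  | Zero, _ | _, Zero => Zero
  | Tan a, Tan b => Tan (a + b)
  | Tan a, Gh b | Gh a, Tan b | Gh a, Gh b => Gh (a + b)
  end.

Definition st_one : st := Tan 0.

(* inverse of a tangible element (only used on tangible elements) *)
Definition st_inv (x : st) : st :=
  match x with Tan a => Tan (- a) | _ => x end.

Definition is_tangible (x : st) : bool := if x is Tan _ then true else false.

(* ghost surpassing on elements: a |=gs b iff a = b, or a is ghost with
   nu(a) >= nu(b)  (nu(-oo) = -oo is below everything). *)
Definition gs (x y : st) : Prop :=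
  x = y \/
  match x with
  | Gh a => match y with Zero => True | Tan b | Gh b => le b a end
  | _ => False
  end.

Definition st_det m (M : 'M[st]_m) : st :=
  \big[st_add/Zero]_(s : 'S_m) \big[st_mul/st_one]_(i < m) M i (s i).

Definition st_mulmx n (A B : 'M[st]_n) : 'M[st]_n :=
  \matrix_(i, j) \big[st_add/Zero]_(k < n) st_mul (A i k) (B k j).

Definition st_scalemx n (c : st) (A : 'M[st]_n) : 'M[st]_n :=
  \matrix_(i, j) st_mul c (A i j).

Definition nonsingular n (A : 'M[st]_n) : bool := is_tangible (st_det A).

Lemma card_setC1_eq n (i j : 'I_n) : #|[set~ j]| = #|[set~ i]|.
Proof. by rewrite !cardsC1. Qed.

(* A_{j,i}: the minor obtained by deleting row j and column i *)
Definition st_minor n (A : 'M[st]_n) (j i : 'I_n) : 'M[st]_(#|[set~ j]|) :=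
  \matrix_(k, l) A (enum_val k) (enum_val (cast_ord (card_setC1_eq i j) l)).

Definition st_adj n (A : 'M[st]_n) : 'M[st]_n :=
  \matrix_(i, j) st_det (st_minor A j i).

Definition st_nabla n (A : 'M[st]_n) : 'M[st]_n :=
  st_scalemx (st_inv (st_det A)) (st_adj A).

Definition principal n (M : 'M[st]_n) (S : {set 'I_n}) : 'M[st]_(#|S|) :=
  \matrix_(k, l) M (enum_val k) (enum_val l).

(* characteristic polynomial f_M(x) = det(xI + M), as the formal polynomial
   whose coefficient of x^k (k <= n) is the sum of the determinants of all
   (n-k)x(n-k) principal submatrices of M, and 0_R = -oo for k > n. *)
Definition charpoly_coef n (M : 'M[st]_n) (k : nat) : st :=
  if (k <= n)%N then
    \big[st_add/Zero]_(S : {set 'I_n} | #|S| == (n - k)%N) st_det (principal M S)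
  else Zero.

Definition gs_poly (f g : nat -> st) : Prop := forall i, gs (f i) (g i).

End Supertropical.

(* Main.v *)
Require Import Defs.
From mathcomp Require Import all_boot all_order all_algebra all_fingroup.
From HB Require Import structures.
From mathcomp.multinomials Require Import mpoly.
Set Implicit Arguments. Unset Strict Implicit. Unset Printing Implicit Defensive.
Import GRing.Theory.
Local Open Scope ring_scope.

(** Let [e_m] denote the sum of the principal minors of size [m].  Over a
    commutative ring [e_m (adj A * B * A) = (det A)^m * e_m B].  Reduced modulo
    2, where determinants are permanents, this is an identity between
    polynomials in the entries of [A] and [B], and it says that every monomial
    occurs with the same parity in both formal expansions.  In the supertropical
    semiring a term repeated at least twice is ghost.  Since [det A] is tangible,
    a single permutation [s] strictly dominates it: on the right-hand side the
    monomials of [s^m * e_m B] are pairwise distinct, occur exactly once, and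
    absorb all the other terms.  Hence the left-hand side is the right-hand side plus
    a ghost, and multiplication by [(det A)^-m] gives the theorem. *)

(** * Permanents and principal minors *)

Section Permanent.
Variable R : comPzSemiRingType.

Definition permanent n (M : 'M[R]_n) : R := \sum_(s : 'S_n) \prod_i M i (s i).

Definition permadj n (A : 'M[R]_n) : 'M[R]_n :=
  \matrix_(i, j) permanent
    (mxsub enum_val (fun l => enum_val (cast_ord (card_setC1_eq i j) l)) A
      : 'M_(#|[set~ j]|)).

Definition permcoef n (M : 'M[R]_n) (m : nat) : R :=
  \sum_(S : {set 'I_n} | #|S| == m)
    permanent (mxsub enum_val enum_val M : 'M_(#|S|)).

(** Reindexing rows and columns permutes the summation over permutations. Two separate sizes are
    allowed because [#|[set~ j]|] and [n.-1] are equal but not convertible. *)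
Lemma permanent_mxsub p q (h h' : 'I_p -> 'I_q) (M : 'M[R]_q) :
  bijective h -> bijective h' -> permanent (mxsub h h' M) = permanent M.
Proof.
move=> bh; have epq := bij_eq_card bh; rewrite !card_ord in epq.
case: q / epq h h' M bh => h h' M /bij_inj hi /bij_inj hi'.
rewrite /permanent (reindex_inj (mulgI (perm hi))) /=.
rewrite (reindex_inj (mulIg (perm hi')^-1%g)) /=.
apply: eq_bigr => s _; rewrite [RHS](reindex_inj hi) /=.
apply: eq_bigr => i _; rewrite mxE !permM; congr (M _ _).
by rewrite -(permE hi') permKV permE.
Qed.

Section ExtendPerm.
Variables (n : nat) (S : {set 'I_n}).
Implicit Type s : 'S_#|S|.

(** The permutation acts on positions in the enumeration of [S]; off [S] the extension is the
    identity. *)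
Definition extend_fun s (i : 'I_n) : 'I_n :=
  if [pick k | enum_val k == i] is Some k then enum_val (s k) else i.

Lemma extend_fun_in s k : extend_fun s (enum_val k) = enum_val (s k).
Proof.
rewrite /extend_fun; case: pickP => [l /eqP/enum_val_inj -> //|/(_ k)].
by rewrite eqxx.
Qed.

Lemma extend_fun_out s i : i \notin S -> extend_fun s i = i.
Proof.
rewrite /extend_fun; case: pickP => [l /eqP <-|//].
by rewrite enum_valP.
Qed.

Lemma extend_fun_inj s : injective (extend_fun s).
Proof.
have inS i : (extend_fun s i \in S) = (i \in S).
  have [iS|iS] := boolP (i \in S); last by rewrite extend_fun_out ?(negPf iS).
  by rewrite -(enum_rankK_in iS iS) extend_fun_in enum_valP.
move=> i j eij; have := inS j; rewrite -eij inS => eS.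
have [iS|iS] := boolP (i \in S); last first.
  by move: eij; rewrite !extend_fun_out // -eS.
have jS : j \in S by rewrite -eS.
move: eij; rewrite -(enum_rankK_in iS iS) -(enum_rankK_in jS jS) !extend_fun_in.
by move/enum_val_inj/perm_inj->.
Qed.

Definition extend_perm s : 'S_n := perm (@extend_fun_inj s).

Lemma extend_perm_inj : injective extend_perm.
Proof.
move=> s t est; apply/permP => k; apply: enum_val_inj.
by rewrite -!extend_fun_in -![extend_fun _ _](permE (@extend_fun_inj _))
  -!/(extend_perm _) est.
Qed.

(** Extension is injective, lands in the permutations supported on [S], and both sets have [#|S|]
    factorial elements. *)
Lemma extend_perm_image :
  [set extend_perm s | s in [set: 'S_#|S|]] = [set t | perm_on S t].
Proof.
apply/eqP; rewrite eqEcard (card_imset _ extend_perm_inj) cardsT card_Sn.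
rewrite cardsE card_perm leqnn andbT; apply/subsetP=> _ /imsetP[s _ ->].
rewrite inE; apply/subsetP => i; rewrite inE permE; apply: contraR => iS.
by rewrite extend_fun_out.
Qed.

End ExtendPerm.

(** All principal minors become sums over the single type ['S_n], whatever the size of [S]. *)
Lemma permanent_principal n (S : {set 'I_n}) (M : 'M[R]_n) :
  permanent (mxsub enum_val enum_val M : 'M_(#|S|))
  = \sum_(t : 'S_n | perm_on S t) \prod_(i in S) M i (t i).
Proof.
rewrite -big_set -extend_perm_image big_imset /=; last first.
  by move=> s t _ _; apply: extend_perm_inj.
apply: eq_big => [s|s _]; first by rewrite inE.
rewrite [RHS]big_enum_val /=.
by apply: eq_bigr => k _; rewrite mxE permE extend_fun_in.
Qed.

Lemma permcoefE n (M : 'M[R]_n) m :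
  permcoef M m = \sum_(t : {set 'I_n} * 'S_n | (#|t.1| == m) && perm_on t.1 t.2)
     \prod_(i in t.1) M i (t.2 i).
Proof.
rewrite -(pair_big_dep (fun S : {set 'I_n} => #|S| == m)
  (fun S (t : 'S_n) => perm_on S t) (fun S (t : 'S_n) => \prod_(i in S) M i (t i))) /=.
by apply: eq_bigr => S _; rewrite permanent_principal.
Qed.

Lemma permcoefZ n c (M : 'M[R]_n) m :
  permcoef (\matrix_(i, j) (c * M i j)) m = c ^+ m * permcoef M m.
Proof.
rewrite !permcoefE mulr_sumr; apply: eq_bigr => -[S t] /= /andP[/eqP <- _].
by under eq_bigr do rewrite mxE; rewrite big_split prodr_const.
Qed.

Lemma permanent_scalarD n (x : R) (M : 'M[R]_n) :
  permanent (\matrix_(i, j) (x * (i == j)%:R + M i j))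
  = \sum_(k < n.+1) x ^+ k * permcoef M (n - k).
Proof.
(* [J] collects the rows where the entry of [M] is chosen. Elsewhere the diagonal factor vanishes
   unless [s] fixes the row, so [s] is supported on [J]. *)
transitivity (\sum_(J : {set 'I_n}) \sum_(s : 'S_n | perm_on J s)
    x ^+ (n - #|J|) * \prod_(i in J) M i (s i)).
  rewrite [RHS](exchange_big_dep xpredT) //=; apply: eq_bigr => s _.
  under eq_bigr do rewrite mxE addrC.
  rewrite bigA_distr [RHS]big_mkcond /=; apply: eq_bigr => J _.
  rewrite (bigID (mem J)) /= mulrC.
  case: ifP => [sJ|].
    congr (_ * _); last by apply: eq_bigr => i ->.
    under eq_bigr => i iJ do rewrite (negPf iJ) (out_perm sJ iJ) eqxx mulr1.
    rewrite prodr_const; have /(congr1 (subn^~ #|J|)) := cardC J.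
    by rewrite /= card_ord addKn => <-.
  move=> /negbT/subsetPn[i]; rewrite inE => si iJ.
  by rewrite (bigD1 i) //= (negPf iJ) eq_sym (negPf si) mulr0 !mul0r.
(* The subsets are sorted by the exponent [n - #|J|]; it is at most [n], so [inord] never takes its
   default value. *)
rewrite (partition_big (fun J : {set 'I_n} => inord (n - #|J|) : 'I_n.+1) xpredT) //=.
apply: eq_bigr => k _; rewrite permcoefE mulr_sumr.
rewrite -(pair_big_dep (fun S : {set 'I_n} => #|S| == (n - k)%N)
  (fun S (t : 'S_n) => perm_on S t)
  (fun S (t : 'S_n) => x ^+ k * \prod_(i in S) M i (t i))) /=.
have le_kn : (k <= n)%N by rewrite -ltnS.
have le_Jn (J : {set 'I_n}) : (#|J| <= n)%N.
  by rewrite -[n in (_ <= n)%N]card_ord max_card.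
apply: eq_big => [J|J /eqP <-].
  rewrite -val_eqE /= inordK ?ltnS ?leq_subr //.
  by apply/eqP/eqP => [<-|->]; rewrite subKn.
by rewrite inordK ?ltnS ?leq_subr.
Qed.

End Permanent.

(** * Relations compatible with sums and products *)

Section PermanentRel.
Variables (R1 R2 : comPzSemiRingType) (E : R1 -> R2 -> Prop).
Hypotheses (E0 : E 0 0) (E1 : E 1 1).
Hypothesis ED : forall x1 x2 y1 y2, E x1 x2 -> E y1 y2 -> E (x1 + y1) (x2 + y2).
Hypothesis EM : forall x1 x2 y1 y2, E x1 x2 -> E y1 y2 -> E (x1 * y1) (x2 * y2).

(** [E] need not be the graph of a map: besides the graph of [polyC] it will be [mod2_eval], which
    relates one polynomial to many values. *)
Lemma permanent_rel n (M1 : 'M[R1]_n) (M2 : 'M[R2]_n) :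
  (forall i j, E (M1 i j) (M2 i j)) -> E (permanent M1) (permanent M2).
Proof.
move=> EMM; apply: (big_ind2 E) => // s _.
by apply: (big_ind2 E).
Qed.

Lemma permadj_rel n (M1 : 'M[R1]_n) (M2 : 'M[R2]_n) :
  (forall i j, E (M1 i j) (M2 i j)) ->
  forall i j, E (permadj M1 i j) (permadj M2 i j).
Proof. by move=> EMM i j; rewrite !mxE; apply: permanent_rel => k l; rewrite !mxE. Qed.

Lemma permcoef_rel n (M1 : 'M[R1]_n) (M2 : 'M[R2]_n) m :
  (forall i j, E (M1 i j) (M2 i j)) -> E (permcoef M1 m) (permcoef M2 m).
Proof.
move=> EMM; apply: (big_ind2 E) => // S _.
by apply: permanent_rel => k l; rewrite !mxE.
Qed.

Lemma mulmx_rel n (M1 N1 : 'M[R1]_n) (M2 N2 : 'M[R2]_n) :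
  (forall i j, E (M1 i j) (M2 i j)) -> (forall i j, E (N1 i j) (N2 i j)) ->
  forall i j, E ((M1 *m N1) i j) ((M2 *m N2) i j).
Proof.
by move=> EM1 EM2 i j; rewrite !mxE; apply: (big_ind2 E) => // k _; apply: EM.
Qed.

End PermanentRel.

(** * Permanents as determinants in characteristic two *)

Section CharTwo.
Variable R : comNzRingType.
Hypothesis char2 : 2 \in [pchar R].

Lemma permanent_det n (M : 'M[R]_n) : permanent M = \det M.
Proof.
apply: eq_bigr => s _; have -> : (-1 : R) = 1 by rewrite oppr_pchar2.
by rewrite expr1n mul1r.
Qed.

Lemma permadj_adj n (A : 'M[R]_n) : permadj A = \adj A.
Proof.
apply/matrixP => i j; rewrite !mxE /cofactor.
have -> : (-1 : R) = 1 by rewrite oppr_pchar2.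
rewrite expr1n mul1r -permanent_det.
(* An injective enumeration of the indices other than [k] differs from [lift k] by a bijection, so
   the minor and the cofactor matrix agree up to reindexing. *)
have bij (k : 'I_n) p (f : 'I_p -> 'I_n) : p = n.-1 -> injective f ->
    (forall l, f l != k) -> exists2 h, bijective h & forall l, f l = lift k (h l).
  move=> ep fi fk; subst p.
  have hk l : {h | f l = lift k h}.
    by have := fk l; rewrite eq_sym => /unlift_some[h -> _]; exists h.
  exists (fun l => sval (hk l)); last by move=> l; case: (hk l).
  apply: injF_bij => l l'; case: (hk l) (hk l') => /= h e [h' e'] eh.
  by apply: fi; rewrite e e' eh.
have enumN k (l : 'I_#|[set~ k]|) : enum_val l != k.
  by have := enum_valP l; rewrite !inE.
have card k : #|[set~ k : 'I_n]| = n.-1 by rewrite cardsC1 card_ord.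
have [h bh eh] := bij j _ _ (card j) enum_val_inj (enumN _ j).
have [//|||h' bh' eh'] := bij i _
  (fun l : 'I_#|[set~ j]| => enum_val (cast_ord (card_setC1_eq i j) l)).
- by move=> l l' /enum_val_inj/cast_ord_inj.
- by move=> l; apply: enumN.
rewrite -(permanent_mxsub _ bh bh'); congr permanent.
by apply/matrixP=> k l; rewrite !mxE eh eh'.
Qed.

End CharTwo.

(* Compares the coefficients in [det (d x I + C) = d ^ n * det (x I + B)], where
   [d = det A], [C = adj A * B * A] and [d I = adj A * A]. *)
Lemma permcoef_conj (R : idomainType) (char2 : 2 \in [pchar R])
    n (A B : 'M[R]_n) m :
  (m <= n)%N -> permanent A != 0 ->
  permcoef (permadj A *m B *m A) m = permanent A ^+ m * permcoef B m.
Proof.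
set d := permanent A => le_mn d_neq0; set C := permadj A *m B *m A.
have char2P : 2 \in [pchar {poly R}] by rewrite (rmorph_pchar polyC).
have mapE (M : 'M[R]_n) k : permcoef (map_mx polyC M) k = (permcoef M k)%:P.
  apply: (@permcoef_rel _ _ (fun p a => p = a%:P)) => //.
  - by move=> p a q b -> ->; rewrite polyCD.
  - by move=> p a q b -> ->; rewrite polyCM.
  - by move=> i j; rewrite mxE.
have coef_perm (c : R) (M : 'M[R]_n) k : (k <= n)%N ->
    (permanent (\matrix_(i, j) (c%:P * 'X * (i == j)%:R + (M i j)%:P)))`_k
      = c ^+ k * permcoef M (n - k).
  move=> le_kn; have -> : (\matrix_(i, j) (c%:P * 'X * (i == j)%:R + (M i j)%:P))
      = \matrix_(i, j) (c%:P * 'X * (i == j)%:R + map_mx polyC M i j).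
    by apply/matrixP=> i j; rewrite !mxE.
  rewrite permanent_scalarD.
  under eq_bigr => i _ do rewrite mapE exprMn mulrAC -polyC_exp -polyCM mul_polyC.
  by rewrite -(poly_def n.+1 (fun i => c ^+ i * permcoef M (n - i))) coef_poly ltnS le_kn.
have eqD : permanent (\matrix_(i, j) (d%:P * 'X * (i == j)%:R + (C i j)%:P))
    = (d ^+ n)%:P *
      permanent (\matrix_(i, j) (1%:P * 'X * (i == j)%:R + (B i j)%:P)).
  rewrite !permanent_det //.
  set X := (X in \det X); set Y := (X in _ * \det X).
  (* This is [adj A * (x I + B) * A = d x I + C]. *)
  have -> : X = map_mx polyC (\adj A) *m Y *m map_mx polyC A.
    have -> : Y = 'X%:M + map_mx polyC B.
      by apply/matrixP=> i j; rewrite !mxE mul1r mulr_natr.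
    rewrite mulmxDr mulmxDl mul_mx_scalar -scalemxAl -!map_mxM mul_adj_mx.
    apply/matrixP=> i j; rewrite !mxE /C permadj_adj // -permanent_det // -/d.
    by rewrite rmorphMn /= mulr_natr mulrC mulrnAr.
  rewrite 2!det_mulmx mulrAC -det_mulmx -map_mxM mul_adj_mx map_scalar_mx det_scalar.
  by rewrite -permanent_det // polyC_exp.
have := congr1 (fun p : {poly R} => p`_(n - m)) eqD.
rewrite coefCM !coef_perm ?leq_subr // subKn // expr1n mul1r.
(* The coefficients of degree [n - m] carry [d ^+ (n - m)] on the left and [d ^+ n] on the right;
   the common nonzero factor cancels. *)
have -> : d ^+ n = d ^+ (n - m) * d ^+ m by rewrite -exprD subnK.
rewrite -mulrA => /mulfI; apply.
by rewrite expf_eq0 (negPf d_neq0) andbF.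
Qed.

(** * The supertropical semiring *)

Section StSemiring.
Variables (G : zmodType) (le : rel G) (hG : ordered_abgroup le).
Implicit Types (a b c : G) (x y z : st G).

Local Notation lt := (lt_ le).

Let le_refl a : le a a. Proof. by case: hG. Qed.
Let le_trans a b c : le a b -> le b c -> le a c.
Proof. by case: hG => _ t _ _ _; apply: t. Qed.
Let le_anti a b : le a b -> le b a -> a = b.
Proof. by case: hG => _ _ t _ _; apply: t. Qed.
Let le_total a b : le a b || le b a. Proof. by case: hG. Qed.
Let le_add a b c : le a b -> le (a + c) (b + c).
Proof. by case: hG => _ _ _ _; apply. Qed.

Lemma st_ltxx a : lt a a = false.
Proof. by rewrite /lt_ le_refl. Qed.

Lemma st_lt_trans a b c : lt a b -> lt b c -> lt a c.
Proof.
move=> /andP[ab nba] /andP[bc ncb]; rewrite /lt_ (le_trans ab bc) /=.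
by apply: contra nba => ca; apply: le_trans ca.
Qed.

Lemma st_le_add2r a b c : le (a + c) (b + c) = le a b.
Proof.
by apply/idP/idP => [/le_add-/(_ (- c))|/le_add-/(_ c)//]; rewrite !addrK.
Qed.

Lemma st_lt_add2r a b c : lt (a + c) (b + c) = lt a b.
Proof. by rewrite /lt_ !st_le_add2r. Qed.

Lemma st_lt_add2l a b c : lt (c + a) (c + b) = lt a b.
Proof. by rewrite ![c + _]addrC st_lt_add2r. Qed.

Lemma st_le_add2l a b c : le (c + a) (c + b) = le a b.
Proof. by rewrite ![c + _]addrC st_le_add2r. Qed.

Variant st_compare a b : bool -> bool -> Prop :=
  | StLt of lt a b : st_compare a b true false
  | StGt of lt b a : st_compare a b false true
  | StEq of a = b : st_compare a b false false.

Lemma st_compareP a b : st_compare a b (lt a b) (lt b a).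
Proof.
have [ab|nab] := boolP (lt a b).
  suff /negPf -> : ~~ lt b a by constructor.
  by apply/negP => /(st_lt_trans ab); rewrite st_ltxx.
have [ba|nba] := boolP (lt b a); first by constructor.
constructor; move: nab nba (le_total a b); rewrite /lt_.
by case lab: (le a b); case lba: (le b a) => // _ _ _; apply: le_anti.
Qed.

(** Splits on every comparison left in the goal and closes the impossible branches, which contain a
    strict cycle of length at most three. *)
Ltac st_cases :=
  repeat (first [progress rewrite /= ?st_lt_add2l ?st_lt_add2r ?st_ltxx //
  | match goal with
    | H : is_true (lt ?a ?a) |- _ => by move: H; rewrite st_ltxx
    | H1 : is_true (lt ?a ?b), H2 : is_true (lt ?b ?a) |- _ =>
        by move: (st_lt_trans H1 H2); rewrite st_ltxx
    | H1 : is_true (lt ?a ?b), H2 : is_true (lt ?b ?c), H3 : is_true (lt ?c ?a) |- _ =>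
        by move: (st_lt_trans (st_lt_trans H1 H2) H3); rewrite st_ltxx
    | |- context [lt ?a ?b] => case: (st_compareP a b) => ?; try subst
    end]).

Lemma st_addC : commutative (@st_add G le).
Proof. by move=> [|a|a] [|b|b] //=; st_cases. Qed.

Lemma st_addA : associative (@st_add G le).
Proof. by move=> [|a|a] [|b|b] [|c|c] //=; st_cases. Qed.

Lemma st_add0 : left_id (@Zero G) (@st_add G le).
Proof. by []. Qed.

Lemma st_mulA : associative (@st_mul G).
Proof. by move=> [|a|a] [|b|b] [|c|c] //=; rewrite addrA. Qed.

Lemma st_mulC : commutative (@st_mul G).
Proof. by move=> [|a|a] [|b|b] //=; rewrite addrC. Qed.

Lemma st_mul1 : left_id (st_one G) (@st_mul G).
Proof. by move=> [|a|a] //=; rewrite add0r. Qed.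

Lemma st_mulDl : left_distributive (@st_mul G) (@st_add G le).
Proof. by move=> [|a|a] [|b|b] [|c|c] //=; st_cases. Qed.

Lemma st_mul0 : left_zero (@Zero G) (@st_mul G).
Proof. by []. Qed.

Lemma st_addii x : st_add le (st_add le x x) x = st_add le x x.
Proof. by case: x => [|a|a] //; st_cases. Qed.

(** The hypothesis makes [y] ghost or -oo, as a doubled tangible element is ghost. The sum is then
    [x] itself or a ghost of value at least that of [x]. *)
Lemma gs_addr x y : st_add le y y = y -> gs le (st_add le x y) x.
Proof.
case: x y => [|a|a] [|b|b] //=; rewrite ?st_ltxx // => _; try by [left | right].
  by case: (st_compareP a b) => [/andP[? _]|_|_]; by [left | right; rewrite /= ?le_refl].
by case: (st_compareP a b) => [/andP[? _]|_|_]; by [left | right; rewrite /= ?le_refl].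
Qed.

(** A tie produces a ghost, so a tangible sum comes from one summand alone; absorption by [Tan a]
    says that the other is strictly smaller. *)
Lemma st_add_tan x y a : st_add le x y = Tan a ->
  (x = Tan a /\ st_add le y (Tan a) = Tan a) \/
  (y = Tan a /\ st_add le x (Tan a) = Tan a).
Proof.
by case: x y => [|b|b] [|c|c] //=; st_cases; try (case=> ?; subst); st_cases;
  by [left | right].
Qed.

Lemma st_add_absorb x y a : st_add le (st_add le x y) (Tan a) = Tan a ->
  st_add le x (Tan a) = Tan a /\ st_add le y (Tan a) = Tan a.
Proof.
by case: x y => [|b|b] [|c|c] //=; st_cases; try (case=> ?; subst); st_cases.
Qed.

Lemma st_add_tanxx a : st_add le (Tan a) (Tan a) <> Tan a.
Proof. by rewrite /= st_ltxx. Qed.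

(** An encoding that gives [strop] its choice structure. *)
Definition st_pickle x : option (G + G) :=
  match x with Zero => None | Tan a => Some (inl a) | Gh a => Some (inr a) end.
Definition st_unpickle (o : option (G + G)) : st G :=
  match o with None => Zero G | Some (inl a) => Tan a | Some (inr a) => Gh a end.
Lemma st_pickleK : cancel st_pickle st_unpickle.
Proof. by case. Qed.

End StSemiring.

(* The proof [hG] is a parameter of the alias so that the semiring instance can be
   inferred from the type. *)
Definition strop (G : zmodType) (le : rel G) (hG : ordered_abgroup le) : Type := st G.

Section StropInstances.
Variables (G : zmodType) (le : rel G) (hG : ordered_abgroup le).
HB.instance Definition _ := Choice.copy (strop hG) (can_type (@st_pickleK G)).
HB.instance Definition _ :=
  GRing.isNmodule.Build (strop hG) (st_addA hG) (st_addC hG) (@st_add0 G le).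
HB.instance Definition _ :=
  GRing.Nmodule_isComPzSemiRing.Build (strop hG)
    (@st_mulA G) (@st_mulC G) (@st_mul1 G) (st_mulDl hG) (@st_mul0 G).
End StropInstances.

(** * Transfer of identities modulo 2 *)

Section Transfer.
Variables (R : comPzSemiRingType) (N : nat) (v : 'I_N -> R).

Definition mnm_eval (m : 'X_{1..N}) : R := \prod_i v i ^+ m i.

Lemma mnm_eval0 : mnm_eval 0%MM = 1.
Proof. by rewrite /mnm_eval big1 // => i _; rewrite mnm0E. Qed.

Lemma mnm_evalD m1 m2 : mnm_eval (m1 + m2)%MM = mnm_eval m1 * mnm_eval m2.
Proof. by rewrite -big_split; apply: eq_bigr => i _; rewrite mnmDE exprD. Qed.

Lemma mnm_eval1 i : mnm_eval U_(i)%MM = v i.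
Proof.
rewrite /mnm_eval (bigD1 i) //= big1 => [|j ji]; rewrite mnm1E ?eqxx ?mulr1 //.
by rewrite eq_sym (negPf ji).
Qed.

Lemma mnm_eval_sum (I : Type) (r : seq I) P (F : I -> 'X_{1..N}) :
  mnm_eval (\sum_(i <- r | P i) F i)%MM = \prod_(i <- r | P i) mnm_eval (F i).
Proof. exact: (big_morph mnm_eval mnm_evalD mnm_eval0). Qed.

(* [u] is the value at [v] of a polynomial with coefficients in nat whose reduction
   modulo 2 is [p]; the polynomial is given as a list of monomials. *)
Definition mod2_eval (u : R) (p : {mpoly 'F_2[N]}) :=
  exists2 l : seq 'X_{1..N}, u = \sum_(m <- l) mnm_eval m & p = \sum_(m <- l) 'X_[m].

Lemma mod2_eval0 : mod2_eval 0 0.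
Proof. by exists [::]; rewrite big_nil. Qed.

Lemma mod2_eval1 : mod2_eval 1 1.
Proof. by exists [:: 0%MM]; rewrite big_seq1 ?mnm_eval0 ?mpolyX0. Qed.

Lemma mod2_evalX i : mod2_eval (v i) 'X_i.
Proof. by exists [:: U_(i)%MM]; rewrite big_seq1 ?mnm_eval1. Qed.

Lemma mod2_evalD u1 p1 u2 p2 :
  mod2_eval u1 p1 -> mod2_eval u2 p2 -> mod2_eval (u1 + u2) (p1 + p2).
Proof. by move=> [l1 -> ->] [l2 -> ->]; exists (l1 ++ l2); rewrite big_cat. Qed.

Lemma mod2_evalM u1 p1 u2 p2 :
  mod2_eval u1 p1 -> mod2_eval u2 p2 -> mod2_eval (u1 * u2) (p1 * p2).
Proof.
move=> [l1 -> ->] [l2 -> ->]; exists [seq (x + y)%MM | x <- l1, y <- l2].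
  rewrite big_allpairs_dep mulr_suml; apply: eq_bigr => m1 _.
  by rewrite mulr_sumr; apply: eq_bigr => m2 _; rewrite mnm_evalD.
rewrite big_allpairs_dep mulr_suml; apply: eq_bigr => m1 _.
by rewrite mulr_sumr; apply: eq_bigr => m2 _; rewrite mpolyXD.
Qed.

(** The coefficient of [w] over ['F_2] is its multiplicity modulo 2. *)
Lemma odd_count_mem (l1 l2 : seq 'X_{1..N}) (w : 'X_{1..N}) :
  \sum_(m <- l1) 'X_[m] = \sum_(m <- l2) 'X_[m] :> {mpoly 'F_2[N]} ->
  odd (count_mem w l1) = odd (count_mem w l2).
Proof.
have coefE l : (\sum_(m <- l) 'X_[m] : {mpoly 'F_2[N]})@_w = (count_mem w l)%:R.
  rewrite raddf_sum /= -sum1_count natr_sum [RHS]big_mkcond.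
  by apply: eq_bigr => m _; rewrite mcoeffX /=; case: eqP.
move/(congr1 (mcoeff w)); rewrite !coefE => /(congr1 val).
by rewrite /= !val_Fp_nat // !modn2; do 2!case: odd.
Qed.

Hypothesis addii : forall x : R, x + x + x = x + x.

(** An even multiple of [x] is 0 or [x + x], and both are additively idempotent. *)
Lemma mulrn_even (x : R) k : ~~ odd k -> x *+ k + x *+ k = x *+ k.
Proof.
have ghost2 j : x *+ 2 *+ j.+1 = x *+ 2.
  by elim: j => // j IH; rewrite mulrS IH !mulr2n addrA !addii.
move=> /even_halfK <-; rewrite -mul2n mulrnA.
case: k./2 => [|j]; first by rewrite addr0.
by rewrite ghost2 !mulr2n addrA !addii.
Qed.

(** Only parities are known for the list behind [u]. A monomial of [la] has odd multiplicity: one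
    copy goes into the main sum and the even rest is idempotent. Any other monomial has even
    multiplicity, hence is idempotent, or lies in [lb] and is absorbed. *)
Lemma mod2_transfer u p (la lb : seq 'X_{1..N}) :
  mod2_eval u p -> p = \sum_(m <- la ++ lb) 'X_[m] -> uniq la ->
  (forall w, w \in la -> w \notin lb) ->
  (forall w, w \in lb ->
     mnm_eval w + \sum_(m <- la) mnm_eval m = \sum_(m <- la) mnm_eval m) ->
  exists2 g, u = \sum_(m <- la) mnm_eval m + g & g + g = g.
Proof.
set t := \sum_(m <- la) _ => -[l -> ->] eql ula dis dom.
have odd_la w : w \in la -> odd (count_mem w l).
  move=> wla; rewrite (odd_count_mem w eql) count_cat count_uniq_mem // wla.
  by rewrite (count_memPn (dis _ wla)).
(* [K x] says that, next to [t], the element [x] may be replaced by an idempotent one. This is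
   stable under sums. *)
pose K x := exists2 g, t + x = t + g & g + g = g.
have K0 : K 0 by exists 0; rewrite ?addr0.
have KD x y : K x -> K y -> K (x + y).
  move=> [g tx gg] [h ty hh]; exists (g + h); last by rewrite addrACA gg hh.
  by rewrite addrA tx addrAC ty addrAC addrA.
suff [x -> [g -> gg]] : exists2 x, \sum_(m <- l) mnm_eval m = t + x & K x by exists g.
(* Equal monomials are grouped, each with its multiplicity in [l]. *)
rewrite -[\sum_(m <- l) _]big_undup_iterop_count /=.
have subla : {subset la <= undup l}.
  by move=> w /odd_la; rewrite mem_undup -has_pred1 has_count; case: count.
rewrite (bigID (mem la)) /= -big_filter.
have perm_la : perm_eq [seq w <- undup l | w \in la] la.
  rewrite uniq_perm ?filter_uniq ?undup_uniq // => w.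
  by rewrite mem_filter; case: (boolP (w \in la)) => //= /subla.
rewrite (perm_big _ perm_la) /=.
have split_la : \sum_(w <- la) iterop (count_mem w l) +%R (mnm_eval w) 0
    = t + \sum_(w <- la) mnm_eval w *+ (count_mem w l).-1.
  rewrite -big_split big_seq [RHS]big_seq; apply: eq_bigr => w /odd_la.
  rewrite -[iterop _ _ _ _]/(_ *+ _).
  by case: count => // c _; rewrite mulrS.
rewrite split_la -addrA.
eexists; first by [].
apply: (KD).
  rewrite big_seq; apply: (big_ind K K0 KD) => w /odd_la ow.
  by exists (mnm_eval w *+ (count_mem w l).-1); rewrite // mulrn_even //; case: count ow.
apply: (big_ind K K0 KD) => w wla; rewrite -[iterop _ _ _ _]/(_ *+ _).
have [ow|ew] := boolP (odd (count_mem w l)); last first.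
  by exists (mnm_eval w *+ (count_mem w l)); rewrite ?mulrn_even.
have wlb : w \in lb.
  have := odd_count_mem w eql; rewrite ow count_cat (count_memPn wla) => /esym.
  by rewrite -has_pred1 has_count; case: count.
exists 0; rewrite ?addr0 //; case: count => [|c]; first by rewrite addr0.
by elim: c => [|c IH]; [apply: (etrans (addrC _ _)); apply: dom
  | rewrite mulrSr addrA IH addrC dom].
Qed.
End Transfer.

(** * Generic matrices and their monomials *)

Section GenericMatrices.
Variable n : nat.

Definition entry : finType := (('I_n * 'I_n) + ('I_n * 'I_n))%type.
Definition avar i j : 'I_#|entry| := enum_rank (inl (i, j) : entry).
Definition bvar i j : 'I_#|entry| := enum_rank (inr (i, j) : entry).

Definition entry_val (R : Type) (A B : 'M[R]_n) (k : 'I_#|entry|) : R :=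
  match enum_val k with inl ij => A ij.1 ij.2 | inr ij => B ij.1 ij.2 end.

Lemma entry_val_avar (R : Type) (A B : 'M[R]_n) i j :
  entry_val A B (avar i j) = A i j.
Proof. by rewrite /entry_val enum_rankK. Qed.

Lemma entry_val_bvar (R : Type) (A B : 'M[R]_n) i j :
  entry_val A B (bvar i j) = B i j.
Proof. by rewrite /entry_val enum_rankK. Qed.

Lemma bvar_eq i j k l : (bvar i j == bvar k l) = (i == k) && (j == l).
Proof. by rewrite (inj_eq enum_rank_inj). Qed.

Definition amon (s : 'S_n) : 'X_{1..#|entry|} := (\sum_i U_(avar i (s i)))%MM.
Definition bmon (t : {set 'I_n} * 'S_n) : 'X_{1..#|entry|} :=
  (\sum_(i in t.1) U_(bvar i (t.2 i)))%MM.

Lemma eval_amon (R : comPzSemiRingType) (A B : 'M[R]_n) s :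
  mnm_eval (entry_val A B) (amon s) = \prod_i A i (s i).
Proof.
by rewrite mnm_eval_sum; apply: eq_bigr => i _; rewrite mnm_eval1 entry_val_avar.
Qed.

Lemma eval_bmon (R : comPzSemiRingType) (A B : 'M[R]_n) t :
  mnm_eval (entry_val A B) (bmon t) = \prod_(i in t.1) B i (t.2 i).
Proof.
by rewrite mnm_eval_sum; apply: eq_bigr => i _; rewrite mnm_eval1 entry_val_bvar.
Qed.

Lemma bmonE t i j : bmon t (bvar i j) = (i \in t.1) && (t.2 i == j).
Proof.
rewrite mnm_sumE; under eq_bigr do rewrite mnm1E bvar_eq.
have [it|it] /= := boolP (i \in t.1); last first.
  by rewrite big1 // => k kt; case: eqP it => // <-; rewrite kt.
by rewrite (bigD1 i) //= eqxx /= big1 ?addn0 // => k /andP[_ /negPf->].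
Qed.

(** The exponents of the variables [bvar i j] reveal the set and the permutation on it; off the set
    the permutation is the identity. *)
Lemma bmon_inj t u : perm_on t.1 t.2 -> perm_on u.1 u.2 -> bmon t = bmon u -> t = u.
Proof.
case: t u => [S s] [T t] /= sS tT st.
have E i j : (i \in S) && (s i == j) = (i \in T) && (t i == j).
  have /= := bmonE (T, t) i j; rewrite -st (bmonE (S, s)) /=.
  by case: (_ && _); case: (_ && _).
have eST : S = T.
  apply/setP=> i; apply/idP/idP => iS.
    by have := E i (s i); rewrite iS eqxx => /esym/andP[].
  by have := E i (t i); rewrite iS eqxx => /andP[].
rewrite -eST in E tT *; congr (_, _); apply/permP => i.
have [iS|iS] := boolP (i \in S); last by rewrite (out_perm sS) ?(out_perm tT).
by have := E i (s i); rewrite iS eqxx => /esym/eqP.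
Qed.

Definition Avars : 'M[{mpoly 'F_2[#|entry|]}]_n := \matrix_(i, j) 'X_(avar i j).
Definition Bvars : 'M[{mpoly 'F_2[#|entry|]}]_n := \matrix_(i, j) 'X_(bvar i j).

Lemma permanent_Avars : permanent Avars = \sum_s 'X_[amon s].
Proof.
apply: eq_bigr => s _; rewrite /amon.
rewrite (big_morph _ (@mpolyXD _ _) (@mpolyX0 _ _)).
by apply: eq_bigr => i _; rewrite mxE.
Qed.

Lemma permcoef_Bvars m :
  permcoef Bvars m =
  \sum_(t : {set 'I_n} * 'S_n | (#|t.1| == m) && perm_on t.1 t.2) 'X_[bmon t].
Proof.
rewrite permcoefE; apply: eq_bigr => t _; rewrite /bmon.
rewrite (big_morph _ (@mpolyXD _ _) (@mpolyX0 _ _)).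
by apply: eq_bigr => i _; rewrite mxE.
Qed.

End GenericMatrices.

(** * Domination of terms *)

Section Dominated.
Variable R : comPzSemiRingType.
Implicit Types x y z : R.

(* Strict domination when [y] is tangible: then [y + y <> y]. *)
Definition dominated x y := x + y = y.

Lemma dominated_trans x y z : dominated x y -> dominated y z -> dominated x z.
Proof. by rewrite /dominated => xy yz; rewrite -{1}yz addrA xy. Qed.

Lemma dominated_mull z x y : dominated x y -> dominated (z * x) (z * y).
Proof. by rewrite /dominated -mulrDr => ->. Qed.

Lemma dominated_mulr z x y : dominated x y -> dominated (x * z) (y * z).
Proof. by rewrite /dominated -mulrDl => ->. Qed.

Lemma dominated_addr x y z : dominated x y -> dominated x (y + z).
Proof. by rewrite /dominated addrA => ->. Qed.

(** One dominated factor suffices when each of the others is dominated or equal. *)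
Lemma dominated_prod (I : finType) (x y : I -> R) i0 :
  dominated (x i0) (y i0) -> (forall i, x i = y i \/ dominated (x i) (y i)) ->
  dominated (\prod_i x i) (\prod_i y i).
Proof.
move=> d0 d; rewrite (bigD1 i0) //= (bigD1 (F := y) i0) //=.
have [->|dd] : \prod_(i | i != i0) x i = \prod_(i | i != i0) y i \/
    dominated (\prod_(i | i != i0) x i) (\prod_(i | i != i0) y i).
- apply: (big_ind2 (fun x y => x = y \/ dominated x y)) => [|a b a' b'|i _]; [by left| |exact: d].
  move=> [->|ab] [->|ab']; [by left| | |]; right.
  + exact: dominated_mull.
  + exact: dominated_mulr.
  + exact: dominated_trans (dominated_mull _ ab') (dominated_mulr _ ab).
- exact: dominated_mulr.
- exact: dominated_trans (dominated_mull _ dd) (dominated_mulr _ d0).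
Qed.

End Dominated.

(** * The adjugate identity up to a ghost *)

Section Core.
Variables (G : zmodType) (le : rel G) (hG : ordered_abgroup le).
Local Notation R := (strop hG).

(** By [st_add_tan], at each addition exactly one side carries the tangible value; the discarded
    side is absorbed term by term. *)
Lemma dominant_term (I : finType) (F : I -> R) a :
  \sum_i F i = Tan a ->
  exists2 i0, F i0 = Tan a & forall i, i != i0 -> dominated (F i) (Tan a).
Proof.
have abs (r : seq I) (P : pred I) : dominated (\sum_(i <- r | P i) F i) (Tan a : R) ->
    forall i, i \in r -> P i -> dominated (F i) (Tan a).
  elim: r => // j r IH; rewrite big_cons => H i; rewrite inE => /orP[/eqP->|ir] Pi.
    by move: H; rewrite Pi => /(st_add_absorb hG)[].
  by apply: IH ir Pi; case: (P j) H => // /(st_add_absorb hG)[].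
suff gen (r : seq I) : uniq r -> \sum_(i <- r) F i = Tan a ->
    exists2 i0, F i0 = Tan a & forall i, i \in r -> i != i0 -> dominated (F i) (Tan a).
  by move=> /(gen _ (index_enum_uniq I))[i0 F0 H]; exists i0 => // i; apply/H/mem_index_enum.
elim: r => [|j r IH] /=; first by rewrite big_nil.
move=> /andP[jr ur]; rewrite big_cons => /(st_add_tan hG)[[Fj dr]|[sr dj]].
  exists j => // i; rewrite inE => /orP[/eqP->|ir _]; first by rewrite eqxx.
  exact: (abs r xpredT dr).
have [i0 F0 H] := IH ur sr; exists i0 => // i; rewrite inE => /orP[/eqP-> _|] //.
exact: H.
Qed.

Lemma tan_exp a m : exists b, (Tan a : R) ^+ m = Tan b.
Proof.
elim: m => [|m [b IH]]; first by exists 0.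
by exists (a + b); rewrite exprS IH.
Qed.

Lemma tan_not_dominated a : ~ dominated (Tan a : R) (Tan a).
Proof. exact: (st_add_tanxx hG). Qed.

Lemma permcoef_adj_conj n (A B : 'M[R]_n) a m : (m <= n)%N ->
  permanent A = Tan a ->
  exists2 g, permcoef (permadj A *m B *m A) m = (Tan a : R) ^+ m * permcoef B m + g
    & g + g = g.
Proof.
move=> le_mn detA.
set v := entry_val A B.
have EA i j : mod2_eval v (A i j) (Avars n i j).
  by rewrite mxE -(entry_val_avar A B); apply: mod2_evalX.
have EB i j : mod2_eval v (B i j) (Bvars n i j).
  by rewrite mxE -(entry_val_bvar A B); apply: mod2_evalX.
have E0 := mod2_eval0 v; have E1 := mod2_eval1 v.
have ED := @mod2_evalD _ _ v; have EM := @mod2_evalM _ _ v.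
have addii : forall x : R, x + x + x = x + x by exact: (st_addii hG).
(* If the generic permanent were 0, transfer with empty lists would make the tangible [permanent A]
   idempotent. *)
have nz : permanent (Avars n) != 0.
  apply/eqP => A0; have := permanent_rel E0 E1 ED EM EA; rewrite A0 detA => E.
  have := mod2_transfer addii (la := [::]) (lb := [::]) E.
  rewrite !big_nil => /(_ erefl erefl) [] // g.
  rewrite add0r => <-; exact: tan_not_dominated.
have := permcoef_rel E0 E1 ED EM m
  (mulmx_rel E0 ED EM (mulmx_rel E0 ED EM (permadj_rel E0 E1 ED EM EA) EB) EA).
have char2 : 2 \in [pchar {mpoly 'F_2[#|entry n|]}].
  by rewrite (rmorph_pchar (@mpolyC #|entry n| 'F_2)) ?pchar_Fp.
rewrite permcoef_conj // permanent_Avars permcoef_Bvars => Emain.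
have [s0 As0 Adom] := dominant_term detA.
pose P := [pred t : {set 'I_n} * 'S_n | (#|t.1| == m) && perm_on t.1 t.2].
(* A function [f] picks one permutation from each of the [m] factors of [permanent A ^+ m]; [f0]
   always picks the dominant one. Thus [la] lists the leading monomials and [lb] all the others. *)
pose mon (f : {ffun 'I_m -> 'S_n}) := (\sum_i amon (f i))%MM.
pose f0 : {ffun 'I_m -> 'S_n} := [ffun => s0].
pose la := [seq (mon f0 + bmon t)%MM | t <- enum P].
pose lb := [seq (mon f + bmon t)%MM | f <- enum (predC1 f0), t <- enum P].
(* The second matrix is arbitrary, since these facts are also needed with [const_mx 1] in place of
   [B]. *)
have eval_mon f (C : 'M[R]_n) :
    mnm_eval (entry_val A C) (mon f) = \prod_i \prod_k A k (f i k).
  by rewrite mnm_eval_sum; apply: eq_bigr => i _; rewrite eval_amon.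
have eval_mon0 (C : 'M[R]_n) : mnm_eval (entry_val A C) (mon f0) = (Tan a : R) ^+ m.
  rewrite eval_mon; under eq_bigr do rewrite ffunE As0.
  by rewrite prodr_const card_ord.
have mon_dom f (C : 'M[R]_n) : f != f0 ->
    dominated (mnm_eval (entry_val A C) (mon f)) (mnm_eval (entry_val A C) (mon f0)).
  move=> ff0; have [i0 fi0] : exists i0, f i0 != s0.
    apply/existsP; apply: contraNT ff0 => /existsPn H.
    by apply/eqP/ffunP => i; rewrite ffunE; apply/eqP/negPn/H.
  rewrite !eval_mon; apply: (dominated_prod (i0 := i0)).
    by rewrite ffunE As0; apply: Adom.
  move=> i; rewrite ffunE As0; have [->|/Adom] := eqVneq (f i) s0; [by left|by right].
have sum_la : \sum_(w <- la) mnm_eval v w = (Tan a : R) ^+ m * permcoef B m.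
  rewrite big_map big_enum permcoefE mulr_sumr; apply: eq_bigr => t _.
  by rewrite mnm_evalD eval_mon0 eval_bmon.
rewrite -sum_la; apply: (mod2_transfer (lb := lb) addii Emain).
- rewrite big_cat big_map big_allpairs_dep !big_enum /=.
  have -> (p : {mpoly 'F_2[#|entry n|]}) : p ^+ m = \prod_(i < m) p.
    by rewrite prodr_const card_ord.
  rewrite bigA_distr_bigA mulr_suml (bigD1 f0) //=.
  have prodE (f : {ffun 'I_m -> 'S_n}) : (\prod_(i < m) 'X_[amon (f i)]) *
      (\sum_(t : {set 'I_n} * 'S_n | P t) 'X_[bmon t])
      = \sum_(t in P) 'X_[mon f + bmon t] :> {mpoly 'F_2[#|entry n|]}.
    rewrite mulr_sumr; apply: eq_bigr => t _; rewrite mpolyXD /mon.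
    by rewrite [in RHS](big_morph _ (@mpolyXD _ _) (@mpolyX0 _ _)).
  rewrite -prodE; congr (_ + _); apply: eq_bigr => f _.
  by rewrite big_enum -prodE.
- rewrite map_inj_in_uniq ?enum_uniq // => t u.
  rewrite !mem_enum => /andP[_ tP] /andP[_ uP] /addmI; exact: bmon_inj.
(* Evaluating the entries of [B] to 1 separates the monomials of [A]. *)
- move=> _ /mapP[t _ ->]; apply/negP => /allpairsP[[f u]] /= [].
  rewrite mem_enum => ff0 _ /(congr1 (mnm_eval (entry_val A (const_mx 1)))).
  rewrite !mnm_evalD !eval_bmon !big1 ?mulr1 => [e|i _|i _]; try by rewrite mxE.
  have := mon_dom f (const_mx 1) ff0; rewrite -e eval_mon0.
  have [b ->] := tan_exp a m; exact: tan_not_dominated.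
(* The monomial given by [f] and [t] is dominated by the member of [la] with the same [t]. *)
- move=> _ /allpairsP[[f t] /= [ff0 tP ->]]; rewrite mem_enum in ff0.
  rewrite big_map (bigD1_seq t) //= ?enum_uniq // !mnm_evalD.
  exact/dominated_addr/dominated_mulr/mon_dom.
Qed.
End Core.

(** * Return to the supertropical definitions *)

Section Translation.
Variables (G : zmodType) (le : rel G) (hG : ordered_abgroup le).
Local Notation R := (strop hG).

Lemma st_detE n (M : 'M[st G]_n) : st_det le M = permanent (M : 'M[R]_n).
Proof. by []. Qed.

Lemma st_adjE n (A : 'M[st G]_n) : st_adj le A = permadj (A : 'M[R]_n).
Proof. by apply/matrixP=> i j; rewrite !mxE st_detE. Qed.

Lemma st_mulmxE n (A B : 'M[st G]_n) :
  st_mulmx le A B = (A : 'M[R]_n) *m (B : 'M[R]_n).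
Proof. by apply/matrixP=> i j; rewrite !mxE. Qed.

Lemma charpoly_coefE n (M : 'M[st G]_n) k : (k <= n)%N ->
  charpoly_coef le M k = permcoef (M : 'M[R]_n) (n - k).
Proof.
rewrite /charpoly_coef => ->; apply: eq_bigr => S _; rewrite st_detE.
by apply: (congr1 (@permanent R #|S|)); apply/matrixP=> i j; rewrite !mxE.
Qed.

End Translation.

Theorem theorem5p4 (G : zmodType) (le : rel G) (hG : ordered_abgroup le)
  (n : nat) (A B B' : 'M[st G]_n) :
  nonsingular le A ->
  B' = st_mulmx le (st_mulmx le (st_nabla le A) B) A ->
  gs_poly le (charpoly_coef le B') (charpoly_coef le B).
Proof.
rewrite /nonsingular (st_detE hG) => tanA -> k.
(* Above degree [n] both coefficients are -oo. *)
have [le_kn|lt_nk] := leqP k n; last first.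
  by rewrite /charpoly_coef leqNgt lt_nk; left.
case detA: (permanent _) tanA => [|a|] // _.
rewrite !(charpoly_coefE hG) // !(st_mulmxE hG).
pose A1 : 'M[strop hG]_n := A; pose B1 : 'M[strop hG]_n := B.
set m := (n - k)%N; pose C := permadj A1 *m B1 *m A1.
have nablaE i j : st_nabla le A i j = (Tan (- a) : strop hG) * permadj A1 i j.
  by rewrite /st_nabla mxE (st_adjE hG) (st_detE hG) detA.
have -> : (st_nabla le A : 'M[strop hG]_n) *m B1 *m A1
    = \matrix_(i, j) ((Tan (- a) : strop hG) * C i j).
  apply/matrixP=> i j; rewrite [LHS]mxE [RHS]mxE [C i j]mxE mulr_sumr.
  apply: eq_bigr => l _; rewrite mulrA; congr (_ * _).
  rewrite [LHS]mxE [(_ *m _) _ _ in RHS]mxE mulr_sumr; apply: eq_bigr => q _.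
  by rewrite nablaE mulrA.
rewrite permcoefZ.
have [g -> gg] := permcoef_adj_conj B1 (leq_subr k n) detA.
have inv : (Tan (- a) : strop hG) ^+ m * (Tan a : strop hG) ^+ m = 1.
  rewrite -exprMn; have -> : (Tan (- a) : strop hG) * (Tan a : strop hG) = 1.
    by rewrite -[RHS]/(Tan 0 : strop hG) -(addNr a).
  by rewrite expr1n.
(* The powers of the determinant and of its inverse cancel, leaving the coefficient of [B] plus a
   multiple of the idempotent [g], which is again idempotent. *)
rewrite mulrDr mulrA inv mul1r.
apply: (gs_addr hG).
have {}gg : (Tan (- a) : strop hG) ^+ m * g + (Tan (- a) : strop hG) ^+ m * g
    = (Tan (- a) : strop hG) ^+ m * g by rewrite -mulrDr gg.
exact: gg.
Qed.
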